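(* Let $H$ be a finite-dimensional Hopf quasigroup over a field $k$ with non-zero left integral $\lambda\in H^*$ on $H$. Then the Fourier transform $F:H\to H^*$, $F(h)(x)=\lambda(x\,S(h))$ for $h,x\in H$, maps the convolution product $*$ in $H$ to the product in $H^*$, that is, $$F(g*h)=F(g)F(h)\qquad\text{for all } g,h\in H.$$
   Context: Let $k$ be a field. A Hopf quasigroup over $k$ is a $k$-vector space $H$ with a unital, not necessarily associative, bilinear product, together with (unital) algebra homomorphisms $\Delta:H\to H\otimes H$ and $\varepsilon:H\to k$ forming a coassociative counital coalgebra, and a linear map $S:H\to H$ (the antipode) such that, in Sweedler notation $\Delta h=h_{(1)}\otimes h_{(2)}$ (summation omitted), for all $h,g\in H$: $S(h_{(1)})(h_{(2)}g)=h_{(1)}(S(h_{(2)})g)=(gS(h_{(1)}))h_{(2)}=(gh_{(1)})S(h_{(2)})=\varepsilon(h)g$. A left integral on $H$ is $\lambda\in H^*$ such that $h_{(1)}\lambda(h_{(2)})=\lambda(h)1$ for all $h\in H$. The product on $H^*$ is $(\varphi\psi)(h)=\varphi(h_{(1)})\psi(h_{(2)})$. The convolution product on $H$ (relative to $\lambda$) is $g*h=h_{(1)}\lambda(h_{(2)}S(g))$. *)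

(* Defs.v *)
From HB Require Import structures.
From mathcomp Require Import all_boot all_order all_algebra.

Set Implicit Arguments.
Unset Strict Implicit.
Unset Printing Implicit Defensive.

Import GRing.Theory.
Local Open Scope ring_scope.

(* The tensor product of two finite-dimensional spaces is modelled by matrices
   of coordinates in the library's chosen bases; [tliftE] and [tlift_uniq]
   give its universal property, so the choice of bases is immaterial. *)
Section Tensor.
Variable k : fieldType.

Definition tensor (U V : vectType k) : Type :=
  'M[k]_(\dim {:U}, \dim {:V}).

Definition tens (U V : vectType k) (u : U) (v : V) : tensor U V :=
  \matrix_(i, j) (coord (vbasis fullv) i u * coord (vbasis fullv) j v).

(* [tlift f t] is the image of t under the linear map induced by the bilinear
   map f: in Sweedler notation, [tlift f (Delta h)] is f(h_(1), h_(2)).  It is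
   meaningful only for bilinear f. *)
Definition tlift (U V : vectType k) (W : lmodType k) (f : U -> V -> W)
    (t : tensor U V) : W :=
  \sum_i \sum_j t i j *: f (vbasis fullv)`_i (vbasis fullv)`_j.

Lemma tlift_is_linear (U V : vectType k) (W : lmodType k) (f : U -> V -> W) :
  linear (tlift f).
Proof.
move=> a s t; rewrite /tlift scaler_sumr -big_split; apply: eq_bigr => i _ /=.
rewrite scaler_sumr -big_split; apply: eq_bigr => j _ /=.
by rewrite !mxE scalerDl scalerA.
Qed.

HB.instance Definition _ (U V : vectType k) (W : lmodType k) (f : U -> V -> W) :=
  GRing.isLinear.Build k (tensor U V) W *:%R (tlift f) (tlift_is_linear f).

Lemma tliftE (U V : vectType k) (W : lmodType k) (f : U -> V -> W) u v :
  bilinear_for *:%R *:%R f -> tlift f (tens u v) = f u v.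
Proof.
move=> fb; pose g : {bilinear U -> V -> W} :=
  HB.pack f (bilinear_isBilinear.Build k U V W *:%R *:%R f fb).
suff: forall g : {bilinear U -> V -> W}, tlift g (tens u v) = g u v.
  by move=> /(_ g).
move=> {}g; rewrite {2}(coord_vbasis (memvf u)) linear_sumlz.
apply: eq_bigr => i _; rewrite linearZl_LR.
rewrite {2}(coord_vbasis (memvf v)) linear_sumr scaler_sumr.
by apply: eq_bigr => j _; rewrite linearZr_LR scalerA mxE.
Qed.

Lemma tlift_uniq (U V : vectType k) (W : lmodType k) (f : U -> V -> W)
    (g : {linear tensor U V -> W}) :
  (forall u v, g (tens u v) = f u v) -> g =1 tlift f.
Proof.
have vfree (Z : vectType k) : free (vbasis {:Z}).
  exact: basis_free (vbasisP _).
move=> gf t; rewrite {1}[t]matrix_sum_delta linear_sum; apply: eq_bigr => i _.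
rewrite linear_sum; apply: eq_bigr => j _; rewrite linearZ -gf /=.
congr (_ *: g _); apply/matrixP => a b; rewrite !mxE !coord_free //.
by rewrite -natrM mulnb (eq_sym i) (eq_sym j).
Qed.

Definition tmap (U V U' V' : vectType k) (f : U -> U') (g : V -> V') :
    tensor U V -> tensor U' V' :=
  tlift (fun u v => tens (f u) (g v)).

Definition tassoc (U V W : vectType k) :
    tensor (tensor U V) W -> tensor U (tensor V W) :=
  tlift (fun s w => tlift (fun u v => tens u (tens v w)) s).

End Tensor.

Record hopfQuasigroup (k : fieldType) (H : vectType k) := HopfQuasigroup {
  hmul : {bilinear H -> H -> H};
  hone : H;
  hdelta : 'Hom(H, tensor H H);
  heps : 'Hom(H, k^o);
  hS : 'Hom(H, H);
  hmul1l : left_id hone hmul;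
  hmul1r : right_id hone hmul;
  hdelta1 : hdelta hone = tens hone hone;
  hdeltaM : forall g h, hdelta (hmul g h) =
    tlift (fun g1 g2 => tlift (fun h1 h2 => tens (hmul g1 h1) (hmul g2 h2))
      (hdelta h)) (hdelta g);
  heps1 : heps hone = 1;
  hepsM : forall g h, heps (hmul g h) = heps g * heps h;
  hcoassoc : forall h,
    tassoc (tmap hdelta id (hdelta h)) = tmap id hdelta (hdelta h);
  hcounitl : forall h, tlift (fun h1 h2 => heps h1 *: h2) (hdelta h) = h;
  hcounitr : forall h, tlift (fun h1 h2 => heps h2 *: h1) (hdelta h) = h;
  hantipodell : forall h g,
    tlift (fun h1 h2 => hmul (hS h1) (hmul h2 g)) (hdelta h) = heps h *: g;
  hantipodelr : forall h g,
    tlift (fun h1 h2 => hmul h1 (hmul (hS h2) g)) (hdelta h) = heps h *: g;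
  hantipoderl : forall h g,
    tlift (fun h1 h2 => hmul (hmul g (hS h1)) h2) (hdelta h) = heps h *: g;
  hantipoderr : forall h g,
    tlift (fun h1 h2 => hmul (hmul g h1) (hS h2)) (hdelta h) = heps h *: g
}.

Section Integrals.
Variables (k : fieldType) (H : vectType k) (A : hopfQuasigroup H).

Definition left_integral (lam : 'Hom(H, k^o)) :=
  forall h, tlift (fun h1 h2 => lam h2 *: h1) (hdelta A h) = lam h *: hone A.

Definition dual_mul (phi psi : 'Hom(H, k^o)) : 'Hom(H, k^o) :=
  linfun (fun h =>
    tlift (fun h1 h2 => (phi h1 * psi h2 : k^o)) (hdelta A h)).

Definition convolution (lam : 'Hom(H, k^o)) (g h : H) : H :=
  tlift (fun h1 h2 => lam (hmul A h2 (hS A g)) *: h1) (hdelta A h).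

Definition fourier (lam : 'Hom(H, k^o)) (h : H) : 'Hom(H, k^o) :=
  linfun (fun x => lam (hmul A x (hS A h))).

(* [linfun] is meaningful only on linear maps; these two lemmas discharge that
   obligation for the two uses above. *)
Lemma dual_mulE phi psi h : dual_mul phi psi h =
  tlift (fun h1 h2 => (phi h1 * psi h2 : k^o)) (hdelta A h).
Proof.
pose f (h1 h2 : H) : k^o := phi h1 * psi h2.
have fl : linear (fun x => tlift f (hdelta A x)).
  by move=> a x y; rewrite !linearP.
pose F : {linear H -> k^o} := HB.pack (fun x => tlift f (hdelta A x))
  (GRing.isLinear.Build k H k^o *:%R (fun x => tlift f (hdelta A x)) fl).
exact: (lfunE F).
Qed.

Lemma fourierE lam h x : fourier lam h x = lam (hmul A x (hS A h)).
Proof.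
have fl : linear (fun x => lam (hmul A x (hS A h))).
  by move=> a y z; rewrite linearPl linearP.
pose F : {linear H -> k^o} := HB.pack (fun x => lam (hmul A x (hS A h)))
  (GRing.isLinear.Build k H k^o *:%R (fun x => lam (hmul A x (hS A h))) fl).
exact: (lfunE F).
Qed.

End Integrals.

(* Main.v *)
Require Import Defs.
From HB Require Import structures.
From mathcomp Require Import all_boot all_order all_algebra.

Set Implicit Arguments.
Unset Strict Implicit.
Unset Printing Implicit Defensive.

Import GRing.Theory.
Local Open Scope ring_scope.

(** The theorem reduces to the following identity in H, valid for a left
    integral lam and all x, h ([left_integral_mulS]):
      x_(1) lam(x_(2) S(h)) = lam(x S(h_(1))) h_(2).
    Applying lam(_ S(g)) to both sides turns it into
      F(g)(x_(1)) F(h)(x_(2)) = lam(x S(h_(1))) lam(h_(2) S(g))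
    whose right-hand side is F(g * h)(x), because
    g * h = h_(1) lam(h_(2) S(g)).

    The identity is obtained by applying lam to the second factor of
      x_(1) # x_(2) S(h) = (x S(h_(1)))_(1) h_(2) # (x S(h_(1)))_(2),
    where # is the tensor sign ([coproduct_mulS]): the integral property makes
    (x S(h_(1)))_(1) lam((x S(h_(1)))_(2)) equal to
    lam(x S(h_(1))) 1.  The tensor identity holds because the coproduct of (x S(h_(1))) h_(2) = eps(h) x, multiplied in
    its second factor by S of one more leg of h, reads
      (x S(h_(1)))_(1) h_(2) # ((x S(h_(1)))_(2) h_(3)) S(h_(4))
        = x_(1) # x_(2) S(h),
    and the last two legs on the left cancel.  These two cancellations are
    antipode axioms, [hantipoderl] and [hantipoderr]. *)

(** * Calculus of Sweedler sums *)

Section Sweedler.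
Variable k : fieldType.

Lemma eq_tlift (U V : vectType k) (W : lmodType k) (f f' : U -> V -> W) t :
  (forall u v, f u v = f' u v) -> tlift f t = tlift f' t.
Proof.
by move=> ff'; apply: eq_bigr => i _; apply: eq_bigr => j _; rewrite ff'.
Qed.

Lemma tliftP (U V : vectType k) (W : lmodType k) (f f' : U -> V -> W) c t :
  tlift (fun u v => c *: f u v + f' u v) t = c *: tlift f t + tlift f' t.
Proof.
rewrite /tlift scaler_sumr -big_split; apply: eq_bigr => i _ /=.
rewrite scaler_sumr -big_split; apply: eq_bigr => j _ /=.
by rewrite scalerDr !scalerA mulrC.
Qed.

Lemma linear_tlift (U V : vectType k) (W W' : lmodType k) (f : U -> V -> W)
    (g : W -> W') t :
  linear g -> g (tlift f t) = tlift (fun u v => g (f u v)) t.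
Proof.
move=> gl; pose G : {linear W -> W'} :=
  HB.pack g (GRing.isLinear.Build k W W' *:%R g gl).
rewrite -[g]/(G : W -> W') /tlift linear_sum; apply: eq_bigr => i _.
by rewrite linear_sum; apply: eq_bigr => j _; rewrite linearZ.
Qed.

Arguments linear_tlift {U V W W' f} g {t}.

Lemma exchange_tlift (U V U' V' : vectType k) (W : lmodType k)
    (f : U -> V -> U' -> V' -> W) t t' :
  tlift (fun u v => tlift (f u v) t') t =
    tlift (fun u' v' => tlift (fun u v => f u v u' v') t) t'.
Proof.
have tlift_pair (X Y : vectType k) (h : X -> Y -> W) s :
    tlift h s = \sum_p s p.1 p.2 *: h (vbasis fullv)`_p.1 (vbasis fullv)`_p.2.
  exact: pair_bigA _ (fun i j => s i j *: h _`_i _`_j).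
rewrite !tlift_pair; under eq_bigr do rewrite tlift_pair scaler_sumr.
rewrite exchange_big; apply: eq_bigr => q _ /=.
rewrite tlift_pair scaler_sumr; apply: eq_bigr => p _.
by rewrite !scalerA mulrC.
Qed.

Lemma tens_bilinear (U V : vectType k) :
  bilinear_for *:%R *:%R (@tens k U V).
Proof.
split=> [v|u] c x y; apply/matrixP=> i j.
  by rewrite !mxE linearP mulrDl mulrA.
by rewrite !mxE linearP mulrDr mulrCA.
Qed.

Lemma tlift_tmap (U V U' V' : vectType k) (W : lmodType k)
    (p : {linear U -> U'}) (q : {linear V -> V'}) (f : U' -> V' -> W) t :
  bilinear_for *:%R *:%R f ->
  tlift f (tmap p q t) = tlift (fun u v => f (p u) (q v)) t.
Proof.
move=> fb; rewrite (linear_tlift _ (linearP (tlift f))).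
by apply: eq_tlift => u v; rewrite /= tliftE.
Qed.

Definition trilinear (U V W : vectType k) (X : lmodType k)
    (f : U -> V -> W -> X) :=
  [/\ forall v w, linear (fun u => f u v w),
      forall u w, linear (fun v => f u v w)
    & forall u v, linear (f u v)].

(** The two sides of coassociativity live in differently bracketed tensor
    products; this is how a function of three legs reads off the
    re-bracketing. *)
Lemma tlift_tassoc (U V W : vectType k) (X : lmodType k)
    (f : U -> V -> W -> X) t : trilinear f ->
  tlift (fun u s => tlift (f u) s) (tassoc t) =
    tlift (fun s w => tlift (fun u v => f u v w) s) t.
Proof.
case=> f1 f2 f3; rewrite (linear_tlift _ (linearP (tlift _))).
apply: eq_tlift => s w; rewrite (linear_tlift _ (linearP (tlift _))).
apply: eq_tlift => u v; rewrite /= tliftE.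
  by rewrite tliftE.
split=> [r|x] c a b; last exact: linearP.
by rewrite -tliftP; apply: eq_tlift => ? ?; rewrite f1.
Qed.

End Sweedler.

Arguments linear_tlift {k U V W W' f} g {t}.

(** * Hopf quasigroups with a left integral *)

Section HopfQuasigroup.
Variables (k : fieldType) (H : vectType k) (A : hopfQuasigroup H).

Local Notation Delta := (hdelta A).
Local Notation S := (hS A).
Local Notation "x ** y" := (hmul A x y) (at level 40, left associativity).

Lemma sweedler_coassoc (W : lmodType k) (f : H -> H -> H -> W) h :
  trilinear f ->
  tlift (fun m h3 => tlift (fun h1 h2 => f h1 h2 h3) (Delta m)) (Delta h) =
    tlift (fun h1 m => tlift (f h1) (Delta m)) (Delta h).
Proof.
move=> ftri; have [f1 f2 f3] := ftri.
have /(congr1 (tlift (fun u s => tlift (f u) s))) := hcoassoc A h.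
rewrite tlift_tassoc // (tlift_tmap Delta idfun) ?(tlift_tmap idfun Delta) //=.
  split=> [r|x] c a b; last exact: linearP.
  by rewrite -tliftP; apply: eq_tlift => ? ?; rewrite f1.
split=> [x|r] c a b; first exact: linearP.
by rewrite -tliftP; apply: eq_tlift => ? ?; rewrite f3.
Qed.

Arguments sweedler_coassoc {W} f {h}.

Lemma tlift_hdeltaM (W : lmodType k) (f : H -> H -> W) g h :
  bilinear_for *:%R *:%R f ->
  tlift f (Delta (g ** h)) =
    tlift (fun g1 g2 => tlift (fun h1 h2 => f (g1 ** h1) (g2 ** h2)) (Delta h))
      (Delta g).
Proof.
move=> fb; rewrite hdeltaM (linear_tlift _ (linearP (tlift f))).
apply: eq_tlift => g1 g2; rewrite (linear_tlift _ (linearP (tlift f))).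
by apply: eq_tlift => h1 h2; rewrite /= tliftE.
Qed.

(** The coproduct of y h_(1) puts a leg of h in each factor, and S of the next
    leg cancels the one in the second factor.  With # the tensor sign:
      y_(1) h # y_(2) = (y h_(1))_(1) # (y h_(1))_(2) S(h_(2)). *)
Lemma coproduct_mul_uncancel (W : lmodType k) (f : H -> H -> W) y h :
  bilinear_for *:%R *:%R f ->
  tlift (fun y1 y2 => f (y1 ** h) y2) (Delta y) =
    tlift (fun m s => tlift (fun u v => f u (v ** S s)) (Delta (y ** m)))
      (Delta h).
Proof.
move=> fb; have [fl fr] := fb.
transitivity (tlift (fun y1 y2 => tlift (fun m s =>
    tlift (fun p r => f (y1 ** p) ((y2 ** r) ** S s)) (Delta m)) (Delta h))
  (Delta y)).
  apply: eq_tlift => y1 y2.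
  rewrite (sweedler_coassoc (fun p r s => f (y1 ** p) ((y2 ** r) ** S s))).
    (* Split the lone h into h and a counit, then expand the counit as the
       antipode cancellation acting on y2. *)
    rewrite -{1}(hcounitr A h) (linear_tlift (fun z => f (y1 ** z) y2)).
      apply: eq_tlift => p q.
      rewrite -(linear_tlift (f (y1 ** p))) // hantipoderr.
      rewrite linearZr_LR /= (GRing.scalable_linear (fr _)).
      exact: (GRing.scalable_linear (fl _)).
    by move=> c u v; rewrite linearPr fl.
  split=> [r s|p s|p r] c u v.
  - by rewrite linearPr fl.
  - by rewrite linearPr linearPl fr.
  - by rewrite linearP linearPr fr.
rewrite exchange_tlift; apply: eq_tlift => m s.
rewrite tlift_hdeltaM //; split=> [v|u] c a b; first exact: fl.
by rewrite linearPl fr.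
Qed.

(** [coproduct_mul_uncancel] at y = x S(h_(1)) produces
    (x S(h_(1))) h_(2), which collapses to x by the other antipode axiom. *)
Lemma coproduct_mulS (W : lmodType k) (f : H -> H -> W) x h :
  bilinear_for *:%R *:%R f ->
  tlift (fun x1 x2 => f x1 (x2 ** S h)) (Delta x) =
    tlift (fun h1 h2 => tlift (fun u v => f (u ** h2) v) (Delta (x ** S h1)))
      (Delta h).
Proof.
move=> fb; have [fl fr] := fb.
pose G s y := tlift (fun u v => f u (v ** S s)) (Delta y).
have Gl s : linear (G s) by move=> c y z; rewrite /G !linearP.
have Gr y : linear (G^~ y).
  move=> c s t; rewrite /G -tliftP; apply: eq_tlift => u v.
  by rewrite linearP linearPr fr.
transitivity (tlift (fun h1 h2 =>
    tlift (fun m s => G s ((x ** S h1) ** m)) (Delta h2)) (Delta h)); last first.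
  by apply: eq_tlift => h1 h2; rewrite coproduct_mul_uncancel.
rewrite -(sweedler_coassoc (fun h1 m s => G s ((x ** S h1) ** m))).
  transitivity (G (tlift (fun n s => heps A n *: s) (Delta h)) x).
    by rewrite hcounitl.
  rewrite (linear_tlift (G^~ x)) //; apply: eq_tlift => n s.
  rewrite -(linear_tlift (G s)) // hantipoderl.
  by rewrite (GRing.scalable_linear (Gr _)) (GRing.scalable_linear (Gl _)).
split=> [m s|h1 s|h1 m] c a b.
- by rewrite linearP linearPr linearPl Gl.
- by rewrite linearPr Gl.
- exact: Gr.
Qed.

Arguments coproduct_mulS {W} f {x h}.

Variables (lam : 'Hom(H, k^o)) (lamI : left_integral A lam).

(** With lam applied to the second factor, the right side of [coproduct_mulS]
    loses its inner coproduct to the integral property, so only the coproduct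
    of h remains. *)
Lemma left_integral_mulS x h :
  tlift (fun x1 x2 => lam (x2 ** S h) *: x1) (Delta x) =
    tlift (fun h1 h2 => lam (x ** S h1) *: h2) (Delta h).
Proof.
rewrite (coproduct_mulS (fun u v => lam v *: u)).
  apply: eq_tlift => h1 h2.
  (* The scalar lam (x ** S h1), carried by the unit, is an integral value. *)
  rewrite -{2}[h2](hmul1l A) -linearZl_LR -lamI.
  rewrite (linear_tlift (fun z => z ** h2)).
    by apply: eq_tlift => u v; rewrite linearZl_LR.
  by move=> c u v; rewrite linearPl.
split=> [v|u] c a b; first by rewrite /= scalerDr !scalerA mulrC.
by rewrite /= linearP scalerDl scalerA.
Qed.

End HopfQuasigroup.

Theorem proposition5p5 (k : fieldType) (H : vectType k) (A : hopfQuasigroup H)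
    (lam : 'Hom(H, k^o)) (lam_neq0 : lam <> 0) (lamI : left_integral A lam)
    (g h : H) :
  fourier A lam (convolution A lam g h) =
    dual_mul A (fourier A lam g) (fourier A lam h).
Proof.
apply/lfunP => x; rewrite fourierE dual_mulE.
have Fl y : linear (fun z => lam (hmul A z (hS A y)) : k^o).
  by move=> c u v; rewrite linearPl linearP.
under [RHS]eq_tlift do rewrite !fourierE.
transitivity (lam (hmul A (tlift (fun x1 x2 => lam (hmul A x2 (hS A h)) *: x1)
  (hdelta A x)) (hS A g))); last first.
  rewrite (linear_tlift _ (Fl g)); apply: eq_tlift => x1 x2.
  by rewrite linearZl_LR linearZ /= mulrC.
rewrite left_integral_mulS // (linear_tlift _ (Fl g)) /convolution.
rewrite (linear_tlift (fun z => lam (hmul A x (hS A z)) : k^o)).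
  apply: eq_tlift => h1 h2.
  by rewrite linearZl_LR !linearZ /=; exact: mulrC.
by move=> c u v; rewrite linearP linearPr linearP.
Qed.
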